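(* Let $\alpha,\beta$ be integers with $\beta\neq 1$, $\alpha\equiv 7\pmod 9$ and $\beta\equiv 1\pmod 9$, and let $n=v_3(\beta-1)$. Then $|G_3|=3^{n+4}$, the nilpotency class of $G_3$ is $3$, $o(a)=9$, $o(b)=3^{n+1}$ and $o(c)=3$.
   Context: $G(\alpha,\beta)=\langle A,B\mid A^{[A,B]}=A^{\alpha},\ B^{[B,A]}=B^{\beta}\rangle$ with $[x,y]=x^{-1}y^{-1}xy$, $y^x=x^{-1}yx$, and $C=[A,B]$. The group $G(\alpha,\beta)$ is finite and nilpotent, hence the direct product of its Sylow subgroups; $G_3$ denotes its Sylow $3$-subgroup and $a,b,c$ denote the images of $A,B,C$ under the canonical projection $G(\alpha,\beta)\to G_3$. $v_3$ is the $3$-adic valuation and $o(x)$ the order of $x$. *)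

(* Defs.v *)
From mathcomp Require Import all_boot all_order all_algebra all_fingroup all_solvable.
Set Implicit Arguments. Unset Strict Implicit. Unset Printing Implicit Defensive.
Import GRing.Theory.

Definition zexpg (gT : finGroupType) (x : gT) (z : int) : gT :=
  match z with
  | Posz n => (x ^+ n)%g
  | Negz n => ((x ^+ n.+1)^-1)%g
  end.

(* The defining relations of G(alpha,beta):  x^[x,y] = x^alpha, y^[y,x] = y^beta.
   MathComp: [~ x, y] = x^-1 * y^-1 * x * y and x ^ y = y^-1 * x * y,
   matching the paper's conventions. *)
Definition Grels (alpha beta : int) (gT : finGroupType) (x y : gT) : Prop :=
  (x ^ [~ x, y])%g = zexpg x alpha /\ (y ^ [~ y, x])%g = zexpg y beta.

(* (G, A, B) is a (finite) realisation of the presented group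
   G(alpha,beta) = < A, B | A^[A,B] = A^alpha, B^[B,A] = B^beta >:
   G is generated by A, B, the relations hold, and G is universal among
   finite groups with two elements satisfying the relations.  Since the
   presented group is finite, this determines (G, A, B) up to isomorphism. *)
Definition is_Gab (alpha beta : int) (gT : finGroupType) (G : {group gT})
    (A B : gT) : Prop :=
  [/\ A \in G, B \in G, G :=: <<[set A; B]>>%g, Grels alpha beta A B &
      forall (hT : finGroupType) (x y : hT), Grels alpha beta x y ->
        exists f : {morphism G >-> hT}, f A = x /\ f B = y].

(* Main.v *)
Require Import Defs.
From mathcomp Require Import all_boot all_order all_algebra all_fingroup all_solvable.
From mathcomp Require Import zify ring.
Set Implicit Arguments. Unset Strict Implicit. Unset Printing Implicit Defensive.
Import GRing.Theory.

(* Nilpotency: let G = <x, y> be a finite group satisfying the relations, with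
   c = [x, y] and trivial center.  Powers of c are central as soon as they
   centralize x and y, so the order of c divides the lcm of totient #[x] and
   totient #[y].  Take the largest prime p dividing #[x] * #[y], with (say)
   p-part p^e of #[x] at least that of #[y].  Then c^N = 1 for a suitable
   N = p^(e-1) m with p not dividing m, and z = x^N has order p, while
   z^y = (x c)^N is a power of x.  So <z> is normal in G; hence c centralizes
   z, p divides a - 1, and then the exponent of x in (x c)^N is congruent to N
   modulo p^e for p odd, which makes z central (for p = 2 this holds because
   #[z] = 2): a contradiction.

   Upper bound: in a 3-group, induction on G / Z(G) makes c^3 central; this
   forces x^9 = 1, y^(3^(n+1)) = 1, [x^3, y] = c^3 and [y^3, x] = c^-3, and
   evaluating y^(x^7) = y^(x^c) in two ways gives c^3 = 1.  Then x^3 and y^3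
   are central and every element is x^i y^j c^k.

   Lower bound: two groups of permutations of Z/3^(k+1), generated by
   s : x |-> x + 1 and t : x |-> x - d x (x + 1) with 3 d = d^2 = 0, are
   images of G; they show x^3 <> 1, y^(3^n) <> 1 and x^3 \notin <y^3>. *)

(** * Relations with natural exponents, and powers of a twisted product *)

Local Open Scope group_scope.

(** Natural exponents suffice: in a finite group an integer exponent may be replaced by a residue
    modulo the element orders. *)
Definition mac_rels (gT : finGroupType) (a b : nat) (x y : gT) : Prop :=
  x ^ [~ x, y] = x ^+ a /\ y ^ [~ y, x] = y ^+ b.

Lemma mac_rels_sym (gT : finGroupType) a b (x y : gT) :
  mac_rels a b x y -> mac_rels b a y x.
Proof. by case. Qed.

Lemma mac_rels_morph (aT rT : finGroupType) (G : {group aT})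
    (f : {morphism G >-> rT}) a b x y :
  x \in G -> y \in G -> mac_rels a b x y -> mac_rels a b (f x) (f y).
Proof.
move=> Gx Gy [rx ry].
by split; rewrite -morphR // -morphJ ?groupR // ?rx ?ry morphX.
Qed.

Lemma conjgX_iter (gT : finGroupType) (x c : gT) a k :
  x ^ c = x ^+ a -> x ^ (c ^+ k) = x ^+ (a ^ k).
Proof.
move=> xc; elim: k => [|k IHk]; first by rewrite conjg1.
by rewrite expgSr conjgM IHk conjXg xc -expgM expnS.
Qed.

(** Moving each [c] to the left raises the factors [x] that it crosses to the power [a]. As x^y = x
    [x,y], this computes the conjugates by [y] of powers of [x]. *)
Lemma expgM_twist (gT : finGroupType) (x c : gT) a k :
  x ^ c = x ^+ a -> (x * c) ^+ k = c ^+ k * x ^+ (\sum_(j < k) a ^ j.+1).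
Proof.
move=> xc; elim: k => [|k IHk]; first by rewrite big_ord0 mulg1.
have xcE : x * c = c * x ^+ a by rewrite conjgC xc.
rewrite expgS IHk big_ord_recr /= [in RHS]addnC expgD !mulgA; congr (_ * _).
by rewrite xcE -mulgA (conjgC (x ^+ a)) conjXg (conjgX_iter _ xc) -expgM mulgA -expgS expnSr.
Qed.

(** * Geometric sums and totients modulo powers of a prime *)

Lemma geom_sumD a m k :
  \sum_(j < m + k) a ^ j.+1 = (\sum_(j < m) a ^ j.+1 + a ^ m * \sum_(j < k) a ^ j.+1)%N.
Proof.
rewrite big_split_ord big_distrr /=; congr addn; apply: eq_bigr => j _.
by rewrite -expnD addnS.
Qed.

Lemma geom_sumM a m k :
  \sum_(j < m * k) a ^ j.+1 =
    ((\sum_(j < m) a ^ j.+1) * \sum_(i < k) (a ^ m) ^ i)%N.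
Proof.
elim: k => [|k IHk]; first by rewrite muln0 !big_ord0 muln0.
by rewrite mulnS addnC geom_sumD IHk big_ord_recr /= mulnDr -!expnM mulnC (mulnC (a ^ _)%N).
Qed.

(** Modulo p^2 the term of index i is 1 + p k i, and the indices add up to 'C(q, 2). *)
Lemma geom_sum_1mod p k q :
  exists c, \sum_(i < q) (1 + p * k) ^ i = (q + p * k * 'C(q, 2) + p ^ 2 * c)%N.
Proof.
elim: q => [|q [c IHq]]; first by exists 0; rewrite big_ord0 bin0n !muln0.
have [d Ed] : exists d, ((1 + p * k) ^ q = 1 + p * k * q + p ^ 2 * d)%N.
  elim: q {IHq} => [|q [d Ed]]; first by exists 0; rewrite !muln0.
  by exists (k * k * q + d * (1 + p * k))%N; rewrite expnSr Ed; lia.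
exists (c + d)%N; rewrite big_ord_recr /= IHq Ed binS bin1; lia.
Qed.

(** Induction on [e]: a sum of n p terms is the sum of the first n terms times the sum of (a^n)^i
    for i < p. The second factor is p modulo p^2, because an odd p divides 'C(p, 2). *)
Lemma geom_sum_pexp p a e m : prime p -> odd p -> a = 1 %[mod p] ->
  \sum_(j < p ^ e * m) a ^ j.+1 = p ^ e * m %[mod p ^ e.+1].
Proof.
move=> p_pr p_odd a1; elim: e => [|e IHe].
  rewrite expn0 expn1 mul1n -modn_summ (eq_bigr (fun=> 1 %% p)).
    by rewrite modn_summ sum_nat_const card_ord muln1.
  by move=> j _; rewrite -modnXm a1 modnXm exp1n.
set n := (p ^ e * m)%N in IHe *.
have p_gt1 := prime_gt1 p_pr.
have p_gt2 : p > 2 by rewrite odd_prime_gt2.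
have an1 : a ^ n = 1 %[mod p] by rewrite -modnXm a1 modnXm exp1n.
have [k Ek] : exists k, (a ^ n = 1 + p * k)%N.
  by exists (a ^ n %/ p)%N; rewrite {1}(divn_eq (a ^ n)%N p) an1 modn_small // addnC mulnC.
have -> : (p ^ e.+1 * m = n * p)%N by rewrite expnSr mulnAC.
rewrite geom_sumM Ek; have [c ->] := geom_sum_1mod p k p.
have /dvdnP[f ->] : p %| 'C(p, 2) by apply: prime_dvd_bin; rewrite // p_gt2.
have -> : (p + p * k * (f * p) + p ^ 2 * c = p * (1 + p * (k * f + c)))%N by lia.
rewrite mulnA [(p ^ _)%N in LHS]expnSr -modnMml -muln_modl IHe muln_modl modnMml -expnSr.
rewrite mulnDr muln1 /n addnC.
have -> : (p ^ e * m * p * (p * (k * f + c)) = p ^ e.+2 * (m * (k * f + c)))%N.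
  by rewrite !expnSr; lia.
by rewrite (mulnC (p ^ e.+2)%N) modnMDl.
Qed.

(** Every prime q dividing [m] is smaller than [p], so [p] divides neither q nor q - 1. *)
Lemma ndvdn_totient p m : prime p -> 0 < m -> ~~ (p %| m) ->
  (forall q, prime q -> q %| m -> q <= p) -> ~~ (p %| totient m).
Proof.
move=> p_pr m_gt0 pNm lep; rewrite totientE // big_seq_cond Euclid_dvd_prod //.
elim/big_ind: _ => // [b1 b2|q]; first by rewrite negb_or => -> ->.
rewrite andbT mem_primes => /and3P[q_pr _ q_m].
have q_gt1 := prime_gt1 q_pr; rewrite Euclid_dvdM // Euclid_dvdX // negb_or.
have neqp : q != p by apply: contraNneq pNm => <-.
have ltqp : q < p by rewrite ltn_neqAle neqp lep.
rewrite (dvdn_prime2 p_pr q_pr) eq_sym (negPf neqp) andbT gtnNdvd //; lia.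
Qed.

(** The totient of p^e is (p - 1) p^(e - 1), and the p'-part of [m] contributes no factor [p]. The
    factor lost here is what keeps x^N nontrivial in the centre argument. *)
Lemma logn_totient_le p m : prime p -> 0 < m ->
  (forall q, prime q -> q %| m -> q <= p) ->
  logn p (totient m) <= (logn p m).-1.
Proof.
move=> p_pr m_gt0 lep; have p_gt1 := prime_gt1 p_pr.
have m'_gt0 : 0 < m`_p^' by rewrite part_gt0.
have nd : logn p (totient m`_p^') = 0.
  apply/eqP; rewrite lognE p_pr totient_gt0 m'_gt0 /= (negPf (ndvdn_totient _ _ _ _)) //.
    by rewrite -prime_coprime // (pnat_coprime (pnat_id p_pr)) // part_pnat.
  by move=> q q_pr q_m; apply: lep => //; apply: dvdn_trans q_m (dvdn_part _ _).
rewrite -{1}(partnC p m_gt0) p_part.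
case: (logn p m) => [|e]; first by rewrite expn0 mul1n nd.
have co : coprime (p ^ e.+1) m`_p^'.
  by rewrite coprimeXl // (pnat_coprime (pnat_id p_pr)) // part_pnat.
have p1_gt0 : 0 < p.-1 by lia.
rewrite totient_coprime // totient_pfactor // lognM ?totient_gt0 //; last first.
  by rewrite muln_gt0 p1_gt0 expn_gt0 (ltnW p_gt1).
rewrite nd addn0 lognM // ?expn_gt0 ?(ltnW p_gt1) // pfactorK //=.
by rewrite lognE (gtnNdvd p1_gt0) ?andbF ?add0n //; lia.
Qed.

(** * Nontrivial centre and nilpotency *)

Lemma mem_center_gen2 (gT : finGroupType) (G : {group gT}) (x y z : gT) :
  G :=: <<[set x; y]>> -> z \in G -> commute z x -> commute z y -> z \in 'Z(G).
Proof.
move=> defG Gz zx zy; rewrite inE Gz defG cent_gen /=.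
by apply/centP => w /set2P[->|->].
Qed.

(** x^a is conjugate to [x], so dividing #[x] by its gcd with [a] must leave #[x] unchanged. *)
Lemma coprime_conjX (gT : finGroupType) (x c : gT) a :
  x ^ c = x ^+ a -> coprime a #[x].
Proof.
move=> xc; have := orderXgcd x a; rewrite -xc orderJ => E.
rewrite coprime_sym /coprime; have := dvdn_gcdl #[x] a => /dvdnP[k Ek].
move: E; rewrite {2}Ek mulnK ?gcdn_gt0 ?order_gt0 // => kE.
have := order_gt0 x; rewrite kE in Ek *; move: Ek; set g := gcdn _ _; nia.
Qed.

Lemma commute_totient (gT : finGroupType) (x c : gT) a k :
  x ^ c = x ^+ a -> totient #[x] %| k -> commute (c ^+ k) x.
Proof.
move=> xc /dvdnP[m ->]; apply/commute_sym/commgP/conjg_fixP.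
rewrite (conjgX_iter _ xc) -{3}[x]expg1; apply/eqP; rewrite eq_expg_mod_order.
by rewrite mulnC expnM -modnXm (Euler_exp_totient (coprime_conjX xc)) modnXm exp1n.
Qed.

Lemma mac_center_ntriv_aux (gT : finGroupType) (G : {group gT}) (x y : gT) a b p :
    G :=: <<[set x; y]>> -> mac_rels a b x y ->
    prime p -> p %| #[x] -> logn p #[y] <= logn p #[x] ->
    (forall q, prime q -> q %| #[x] -> q <= p) ->
    (forall q, prime q -> q %| #[y] -> q <= p) ->
  'Z(G) != 1.
Proof.
move=> defG [rx ry] p_pr p_x le_yx le_x le_y; apply: contraTneq isT => Z1.
have Gx : x \in G by rewrite defG mem_gen ?set21.
have Gy : y \in G by rewrite defG mem_gen ?set22.
have in_Z z : z \in G -> commute z x -> commute z y -> z = 1.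
  by move=> Gz zx zy; apply/set1P; rewrite -[[set 1]]/(1 : {set gT}) -Z1 (mem_center_gen2 defG).
set c := [~ x, y] in rx; have cV : [~ y, x] = c^-1 by rewrite invg_comm.
rewrite cV in ry; have p_gt1 := prime_gt1 p_pr.
set E := logn p #[x] in le_yx.
have E_gt0 : 0 < E by rewrite logn_gt0 mem_primes p_pr order_gt0.
set L := lcmn (totient #[x]) (totient #[y]).
have cL : c ^+ L = 1.
  apply: in_Z; first by rewrite groupX ?groupR.
    exact: commute_totient rx (dvdn_lcml _ _).
  apply/commute_sym; rewrite -[c]invgK expVgn; apply: commuteV; apply/commute_sym.
  exact: commute_totient ry (dvdn_lcmr _ _).
have L_gt0 : 0 < L by rewrite lcmn_gt0 !totient_gt0 !order_gt0.
have logL : logn p L <= E.-1.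
  rewrite logn_lcm ?totient_gt0 ?order_gt0 // geq_max.
  have := logn_totient_le p_pr (order_gt0 x) le_x.
  have := logn_totient_le p_pr (order_gt0 y) le_y; rewrite -/E; lia.
(* The first factor of [m] makes [N] below a multiple of [L]; the factor [r] cancels the p'-part of
   #[x], so that x^N has order exactly [p]. *)
set r := (#[x]`_p^')%N; set m := (L`_p^' * r)%N.
have r_gt0 : 0 < r by rewrite part_gt0.
have co_p k : coprime p (k`_p^')%N by rewrite (pnat_coprime (pnat_id p_pr)) // part_pnat.
have co_pm : coprime p m by rewrite coprimeMr !co_p.
have xE : #[x] = (p ^ E * r)%N by rewrite -p_part partnC.
set N := (p ^ E.-1 * m)%N.
have pE : (p ^ E = p ^ E.-1 * p)%N by rewrite -expnSr prednK.
have cN : c ^+ N = 1.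
  apply/eqP; rewrite -order_dvdn (@dvdn_trans L) //; first by rewrite order_dvdn cL.
  by rewrite -(partnC p L_gt0) p_part dvdn_mul ?dvdn_exp2l ?dvdn_mulr.
set z := x ^+ N.
have zp : z ^+ p = 1.
  apply/eqP; rewrite -expgM -order_dvdn xE pE /N /m.
  by apply/dvdnP; exists (L`_p^')%N; lia.
have z_nt : z != 1.
  rewrite -order_dvdn xE pE /N; apply/negP => /(dvdn_trans (dvdn_mulr _ (dvdnn _))).
  rewrite dvdn_pmul2l ?expn_gt0 ?(ltnW p_gt1) //.
  by apply/negP; rewrite -prime_coprime.
have oz : #[z] = p := nt_prime_order p_pr zp z_nt.
have zy : z ^ y = x ^+ (\sum_(j < N) a ^ j.+1).
  by rewrite /z conjXg conjg_mulR (expgM_twist _ rx) cN mul1g.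
(* Both sides lie in the cyclic group <x>, which has only one subgroup of each order. *)
have zyz : <[z]> :^ y = <[z]>.
  rewrite -cycleJ; apply/eqP.
  rewrite (@eq_subG_cyclic _ <[x]>) ?cycle_cyclic ?cycle_subG ?mem_cycle // ?zy ?mem_cycle //.
  by rewrite -zy -!orderE orderJ.
have zx : commute z x by apply/commute_sym/commuteX.
(* Expand [c]: [x] centralizes <z> and [y] normalizes it, so [c] fixes [z], whereas it also raises
   [z] to the power [a]. *)
have za : a = 1 %[mod p].
  apply/eqP; rewrite -oz -eq_expg_mod_order expg1; apply/eqP.
  rewrite /z -expgM mulnC expgM -rx -conjXg -/z.
  have zyV : z ^ y^-1 \in <[z]> by rewrite -mem_conjg zyz cycle_id.
  have zyVx : (z ^ y^-1) ^ x = z ^ y^-1.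
    by case/cycleP: zyV => i ->; apply/conjg_fixP/commgP/commute_sym/commuteX/commute_sym.
  have zxV : z ^ x^-1 = z by apply/conjg_fixP/commgP/commuteV.
  have cE : c = x^-1 * (y^-1 * (x * y)) by [].
  by rewrite cE !conjgM zxV zyVx -conjgM mulVg conjg1.
have z_y : commute z y.
  have [p_odd | p2] := boolP (odd p).
    (* The congruence holds modulo p^E only, while [x] has order p^E r. Hence the r-th power, which
       still generates <z> because [r] is prime to [p]. *)
    have geo := geom_sum_pexp E.-1 m p_pr p_odd za.
    have zry : commute (z ^+ r) y.
      apply/commgP/conjg_fixP; rewrite conjXg zy -!expgM; apply/eqP.
      rewrite eq_expg_mod_order xE -!muln_modl; apply/eqP; congr muln.
      by rewrite -(prednK E_gt0).
    have : z \in <[z ^+ r]>.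
      have := generator_coprime z r; rewrite oz co_p => /eqP <-.
      exact: cycle_id.
    by case/cycleP => i ->; apply/commute_sym/commuteX/commute_sym.
  have p_2 : p = 2 by case: (even_prime p_pr) p2 => // ->.
  have : z ^ y \in <[z]> by rewrite -zyz memJ_conjg cycle_id.
  rewrite cycle2g ?oz // !inE conjg_eq1 (negPf z_nt) => /eqP zyE.
  exact/commgP/conjg_fixP.
by rewrite (in_Z z) ?eqxx ?groupX // in z_nt.
Qed.

Lemma mac_center_ntriv (gT : finGroupType) (G : {group gT}) (x y : gT) a b :
  G :=: <<[set x; y]>> -> mac_rels a b x y -> G :!=: 1 -> 'Z(G) != 1.
Proof.
move=> defG rxy ntG; set k := (#[x] * #[y])%N.
have k_gt0 : 0 < k by rewrite muln_gt0 !order_gt0.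
have k_gt1 : 1 < k.
  rewrite ltn_neqAle k_gt0 andbT eq_sym; apply: contra ntG.
  rewrite muln_eq1 !order_eq1 => /andP[/eqP x1 /eqP y1].
  by rewrite defG x1 y1 setUid; apply/eqP; exact: cycle1.
set p := max_pdiv k; have p_pr : prime p := max_pdiv_prime k_gt1.
have le q : prime q -> (q %| #[x]) || (q %| #[y]) -> q <= p.
  move=> q_pr q_xy; apply: max_pdiv_max.
  by rewrite inE mem_primes q_pr k_gt0 Euclid_dvdM.
have le_x q : prime q -> q %| #[x] -> q <= p by move=> q_pr q_x; rewrite le ?q_x.
have le_y q : prime q -> q %| #[y] -> q <= p by move=> q_pr q_y; rewrite le ?q_y ?orbT.
have p_k : (p %| #[x]) || (p %| #[y]) by rewrite -Euclid_dvdM // max_pdiv_dvd.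
have logE z : (p %| #[z]) = (0 < logn p #[z]) by rewrite logn_gt0 mem_primes p_pr order_gt0.
(* By the symmetry of the relations, the generator with the larger p-part can be put first. *)
have [le_yx | lt_xy] := leqP (logn p #[y]) (logn p #[x]).
  apply: (mac_center_ntriv_aux defG rxy p_pr) => //.
  by move: p_k; rewrite !logE; lia.
apply: (mac_center_ntriv_aux _ (mac_rels_sym rxy) p_pr) => //; last exact: ltnW.
  by rewrite setUC.
by rewrite logE; lia.
Qed.

Lemma mac_quotient (gT : finGroupType) (G N : {group gT}) (x y : gT) a b :
    N <| G -> G :=: <<[set x; y]>> -> mac_rels a b x y ->
  G / N = <<[set coset N x; coset N y]>> /\ mac_rels a b (coset N x) (coset N y).
Proof.
move=> /andP[_ nNG] defG rxy.
have Gx : x \in G by rewrite defG mem_gen ?set21.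
have Gy : y \in G by rewrite defG mem_gen ?set22.
split; last by apply: (mac_rels_morph (coset_morphism N) _ _ rxy); apply: (subsetP nNG).
have sN : [set x; y] \subset 'N(N).
  by apply: subset_trans nNG; rewrite defG subset_gen.
by rewrite defG quotient_gen // /quotient morphimU !morphim_set1 ?(subsetP nNG).
Qed.

(** Induction on the order: the relations pass to the quotient by the centre, which is smaller than
    [G] unless [G] is trivial. *)
Lemma mac_nilpotent (gT : finGroupType) (G : {group gT}) (x y : gT) a b :
  G :=: <<[set x; y]>> -> mac_rels a b x y -> nilpotent G.
Proof.
have [k] := ubnP #|G|; elim: k gT G x y => // k IHk gT G x y ltGk defG rxy.
have [-> | ntG] := eqVneq (G : {set gT}) 1; first exact: nilpotent1.
rewrite -quotient_center_nil.
have [defQ rQ] := mac_quotient (center_normal G) defG rxy.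
apply: IHk defQ rQ; rewrite -ltnS; apply: leq_trans ltGk; rewrite ltnS.
by rewrite ltn_quotient ?center_sub // (mac_center_ntriv defG rxy).
Qed.

(** * Consequences of the relations in a 3-group, and the upper bound *)

Lemma expg_eq_mod (gT : finGroupType) (x : gT) N i j :
  x ^+ N = 1 -> i = j %[mod N] -> x ^+ i = x ^+ j.
Proof. by move=> xN ij; rewrite -(expg_mod i xN) ij expg_mod. Qed.

(** #[x] is a power of [p] that divides k - 1. *)
Lemma p_elt_expg_id (gT : finGroupType) (x : gT) p k e :
  prime p -> p.-elt x -> 1 < k -> x ^+ k = x -> logn p k.-1 = e -> x ^+ (p ^ e) = 1.
Proof.
move=> p_pr px k_gt1 xk <-; apply/eqP; rewrite -order_dvdn.
have /p_natP[f xE] := px; rewrite xE dvdn_Pexp2l ?prime_gt1 // -pfactor_dvdn ?ltn_predRL //.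
have : x ^+ k == x ^+ 1 by rewrite xk expg1.
by rewrite eq_expg_mod_order xE eqn_mod_dvd ?(ltnW k_gt1) // subn1.
Qed.

(** b^3 - 1 = (b - 1)(b^2 + b + 1), and the last factor is 3 modulo 9. *)
Lemma logn_exp3 b : b = 1 %[mod 3] -> 1 < b -> logn 3 (b ^ 3).-1 = (logn 3 b.-1).+1.
Proof.
move=> b1 b_gt1; have Eb := divn_eq b 3; rewrite b1 (_ : 1 %% 3 = 1)%N // in Eb.
set q := (b %/ 3)%N in Eb; have q_gt0 : 0 < q by lia.
have b1E : (b.-1 = q * 3)%N by lia.
have -> : ((b ^ 3).-1 = b.-1 * 3 * (1 + 3 * (q + q * q)))%N.
  have -> : (b ^ 3 = (q * 3 * 3 * (1 + 3 * (q + q * q))).+1)%N by rewrite Eb -[RHS]addn1; ring.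
  by rewrite b1E.
have b1_gt0 : 0 < b.-1 by lia.
rewrite lognM ?muln_gt0 ?b1_gt0 // lognM // (@pfactorK 3 1) // addn1.
by rewrite [X in _ + X]lognE dvdn_addl ?dvdn_mulr ?andbF ?addn0.
Qed.

(** As c^3 fixes [x], x = x^(a^3) with v_3(a^3 - 1) = 2; likewise for [y]. The last two equations
    expand the cubes of x^y = x c and y^x = y c^-1. *)
Lemma mac_cube_consequences (gT : finGroupType) (x y : gT) a b
    (c := [~ x, y]) (n := logn 3 b.-1) :
    mac_rels a b x y -> a = 7 %[mod 9] -> b = 1 %[mod 9] -> 1 < b ->
    3.-elt x -> 3.-elt y -> commute (c ^+ 3) x -> commute (c ^+ 3) y ->
  [/\ x ^+ 9 = 1, y ^+ (3 ^ n.+1) = 1 & [/\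
      commute (x ^+ 3) c, commute (y ^+ 3) c,
      (x ^+ 3) ^ y = c ^+ 3 * x ^+ 3 & (y ^+ 3) ^ x = c ^- 3 * y ^+ 3]].
Proof.
move=> [rx ry] a7 b1 b_gt1 px py c3x c3y; have cV : [~ y, x] = c^-1 by rewrite invg_comm.
rewrite cV in ry; rewrite -/c in rx.
have mod3 k i : k = i %[mod 9] -> k = i %[mod 3].
  by move=> ki; rewrite -(modn_dvdm k (isT : 3 %| 9)) ki modn_dvdm.
have a_gt1 : 1 < a by case: (a) a7 => [|[]].
have la : logn 3 a.-1 = 1%N.
  have Ea := divn_eq a 9; rewrite a7 (_ : 7 %% 9 = 7)%N // in Ea.
  set q := (a %/ 9)%N in Ea; have -> : (a.-1 = 3 ^ 1 * (q * 3 + 2))%N by lia.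
  rewrite lognM // ?addn_gt0 ?orbT // pfactorK // lognE dvdn_addr ?dvdn_mull //.
  by rewrite (_ : 3 %| 2 = false) ?andbF.
have x9 : x ^+ 9 = 1.
  apply: (@p_elt_expg_id _ x 3 (a ^ 3) 2) => //; last by rewrite logn_exp3 ?la //; apply: mod3 a7.
    exact: leq_trans a_gt1 (@leq_pexp2l a 1 3 (ltnW a_gt1) isT).
  by rewrite -(conjgX_iter 3 rx); apply/conjg_fixP/commgP/commute_sym.
have y3n : y ^+ (3 ^ n.+1) = 1.
  apply: (@p_elt_expg_id _ y 3 (b ^ 3) _) => //; last by rewrite logn_exp3 // (mod3 b 1%N).
    exact: leq_trans b_gt1 (@leq_pexp2l b 1 3 (ltnW b_gt1) isT).
  rewrite -(conjgX_iter 3 ry) expVgn; apply/conjg_fixP/commgP/commute_sym/commute_sym.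
  exact/commuteV/commute_sym.
have /dvdnP[v bE] : 3 ^ n %| b.-1 by apply: pfactor_dvdnn.
have n_gt0 : 0 < n by rewrite logn_gt0 mem_primes /= -subn1 -eqn_mod_dvd ?(mod3 b 1%N) //; lia.
have bS : (b = 1 + v * 3 ^ n)%N by lia.
have x7 : x ^+ a = x ^+ 7 := expg_eq_mod x9 a7.
rewrite x7 in rx.
split=> //; split.
- apply/commgP/conjg_fixP; rewrite conjXg rx -expgM.
  exact: expg_eq_mod x9 _.
- rewrite -[c]invgK; apply/commuteV/commgP/conjg_fixP; rewrite conjXg ry -expgM.
  apply: expg_eq_mod y3n _; rewrite bS mulnDl mul1n -mulnA -expnSr addnC.
  by rewrite modnMDl.
- rewrite conjXg conjg_mulR (expgM_twist _ rx) -/c; congr (_ * _).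
  by apply: expg_eq_mod x9 _; rewrite !big_ord_recl big_ord0.
rewrite conjXg conjg_mulR cV (expgM_twist _ ry) expVgn; congr (_ * _).
apply: expg_eq_mod y3n _; rewrite !big_ord_recl big_ord0 /= !/bump /=.
(* With t = v 3^n the sum is 3 + 6 t + 4 t^2 + t^3; 3^(n+1) divides 6 t and, as n > 0, also t^2. *)
have -> : (b ^ 1 + (b ^ 2 + (b ^ 3 + 0)) =
    (v * 2 + v * v * 3 ^ n.-1 * 4 + v * v * v * 3 ^ n.-1 * 3 ^ n) * 3 ^ n.+1 + 3)%N.
  rewrite bS (expnS 3 n); have -> : (3 ^ n = 3 * 3 ^ n.-1)%N by rewrite -expnS prednK.
  by ring.
by rewrite modnMDl.
Qed.

(** Put d = c^3 and b = 1 + 9 k. Conjugating [y] by x^7 = x^3 x^3 x gives y c^-1 d^-2, while x^7 =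
    c^-1 x c gives y c^-1 d^(-3k). So d^2 = d^(3k), which for a nontrivial 3-element would force 2 =
    3 k modulo 3. *)
Lemma mac_comm_cube1_aux (gT : finGroupType) (x y : gT) a b (c := [~ x, y]) :
    mac_rels a b x y -> a = 7 %[mod 9] -> b = 1 %[mod 9] -> 1 < b ->
    3.-elt x -> 3.-elt y -> 3.-elt c ->
    commute (c ^+ 3) x -> commute (c ^+ 3) y ->
  c ^+ 3 = 1.
Proof.
move=> rxy a7 b1 b_gt1 px py pc c3x c3y.
have [x9 _ [_ y3c x3y y3x]] := mac_cube_consequences rxy a7 b1 b_gt1 px py c3x c3y.
have [rx ry] := rxy; rewrite -/c in rx.
rewrite (expg_eq_mod x9 a7) in rx; rewrite -[[~ y, x]]invg_comm -/c in ry.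
rewrite -/c in c3x c3y y3c x3y y3x.
set d := c ^+ 3 in c3x c3y x3y y3x.
have dx3 : commute d (x ^+ 3) by apply: commuteX.
have fixd u : commute d u -> d^-1 ^ u = d^-1.
  by move=> du; apply/conjg_fixP/commgP/commute_sym/commuteV/commute_sym.
have yx3 : y ^ (x ^+ 3) = y * d^-1.
  apply: (mulIg d); rewrite mulgKV -[d in LHS](conjg_fixP (introT commgP dx3)).
  by rewrite -conjMg conjgE -mulgA -x3y -conjgC mulKg.
have yx : y ^ x = y * c^-1 by rewrite conjg_mulR invg_comm.
(* These instances fix the inferred group structure; rewriting with the library
   lemmas themselves leaves terms that later rewrites fail to match. *)
have conjM (u v w : gT) : u ^ (v * w) = (u ^ v) ^ w := conjgM u v w.
have mulA (u v w : gT) : u * (v * w) = u * v * w := mulgA u v w.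
have mulJ (u v w : gT) : (u * v) ^ w = u ^ w * v ^ w := conjMg u v w.
have E1 : y ^ (x ^+ 7) = y * c^-1 * d^-1 * d^-1.
  have -> : x ^+ 7 = x ^+ 3 * x ^+ 3 * x by rewrite -expgD -expgSr.
  rewrite (conjM _ (_ * _) x) (conjM y (x ^+ 3)) yx3 mulJ yx3 fixd //.
  by rewrite !mulJ yx !fixd.
have /dvdnP[k Ek] : 9 %| b - 1 by rewrite -eqn_mod_dvd ?(ltnW b_gt1) //; apply/eqP.
have {Ek} bE : b = (1 + 3 * (3 * k))%N by lia.
have cd : commute d c by rewrite /d; apply/commute_sym/commuteX.
have ybc : (y ^+ b) ^ c = y by rewrite -ry -conjgM mulVg conjg1.
have x_c : c^-1 * x * c = x ^+ 7 by rewrite -rx conjgE -mulgA.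
have E2 : y ^ (x ^+ 7) = y * c^-1 * d ^- (3 * k).
  (* [Y] is y^(b - 1): it commutes with [c] since y^3 does, and conjugation by [x] multiplies it by
     d^(-3k). *)
  set Y := y ^+ (3 * (3 * k)).
  have Yc : commute Y c by rewrite /Y expgM; apply/commute_sym/commuteX/commute_sym.
  have YcV : c^-1 * Y = Y * c^-1 by apply/commute_sym/commuteV.
  have YcJ : Y ^ c = Y by apply/conjg_fixP/commgP.
  have Yx : Y ^ x = d ^- (3 * k) * Y.
    rewrite /Y expgM conjXg y3x expgMn ?expVgn //.
    exact/commute_sym/commuteV/commute_sym/commuteX.
  have dkc : d ^- (3 * k) ^ c = d ^- (3 * k).
    by apply/conjg_fixP/commgP/commute_sym/commuteV/commuteX/commute_sym.
  have cJ : c^-1 ^ c = c^-1 by apply/conjg_fixP/commgP/commute_sym/commuteV.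
  have yE : y ^+ b = y * Y by rewrite bE (expgD y 1) expg1.
  have yYc : y ^ c * Y = y by rewrite -{1}YcJ -mulJ -yE.
  have Yd : commute (d ^- (3 * k)) Y.
    by apply/commuteX/commute_sym/commuteV/commuteX/commute_sym.
  rewrite -x_c (conjM y (c^-1 * x) c) (conjM y c^-1 x) ry yE (mulJ y Y x) yx Yx.
  rewrite (mulJ (y * c^-1)) (mulJ y) (mulJ (d ^- (3 * k))) cJ dkc YcJ Yd.
  transitivity (y ^ c * Y * c^-1 * d ^- (3 * k)); last by rewrite yYc.
  by rewrite -(mulA (y ^ c) Y c^-1) -YcV -!mulgA.
have /eqP : d ^+ 2 = d ^+ (3 * k).
  have := etrans (esym E1) E2; rewrite -(mulA (y * c^-1)) => /mulgI.
  by rewrite -invMg => /invg_inj.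
rewrite eq_expg_mod_order => /eqP dk.
have /p_natP[[|e] oe] : 3.-elt d by apply: (mem_p_elt (G := <[c]>%G)); rewrite ?mem_cycle.
  by apply/eqP; rewrite -order_eq1 oe.
have : 2 = 3 * k %[mod 3].
  by rewrite -(@modn_dvdm #[d]) ?dk ?modn_dvdm // oe expnS dvdn_mulr.
by rewrite mulnC modnMl.
Qed.

Lemma mac_comm_cube1 (gT : finGroupType) (G : {group gT}) (x y : gT) a b :
    3.-group G -> G :=: <<[set x; y]>> -> mac_rels a b x y ->
    a = 7 %[mod 9] -> b = 1 %[mod 9] -> 1 < b ->
  [~ x, y] ^+ 3 = 1.
Proof.
move=> + + + a7 b1 b_gt1; have [k] := ubnP #|G|.
elim: k gT G x y => // k IHk gT G x y ltGk pG defG rxy.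
have [G1 | ntG] := eqVneq (G : {set gT}) 1.
  have /set1P-> : x \in 1%G by rewrite /= -G1 defG mem_gen ?set21.
  by rewrite comm1g expg1n.
have [defQ rQ] := mac_quotient (center_normal G) defG rxy.
have Gx : x \in G by rewrite defG mem_gen ?set21.
have Gy : y \in G by rewrite defG mem_gen ?set22.
have Gc : [~ x, y] \in G by rewrite groupR.
have nZ : G \subset 'N('Z(G)) := normal_norm (center_normal G).
have cQ : [~ x, y] ^+ 3 \in 'Z(G).
  apply: coset_idr; first by rewrite groupX ?(subsetP nZ).
  rewrite morphX ?(subsetP nZ) // morphR ?(subsetP nZ) //.
  apply: IHk (quotient_pgroup _ pG) defQ rQ; rewrite -ltnS; apply: leq_trans ltGk.
  by rewrite ltnS ltn_quotient ?center_sub // (mac_center_ntriv defG rxy).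
have [_ /centP cG] := setIP cQ.
by apply: (mac_comm_cube1_aux rxy); rewrite // ?(mem_p_elt pG) //; apply: cG.
Qed.

Lemma mac3_basic (gT : finGroupType) (G : {group gT}) (x y : gT) a b
    (c := [~ x, y]) (n := logn 3 b.-1) :
    3.-group G -> G :=: <<[set x; y]>> -> mac_rels a b x y ->
    a = 7 %[mod 9] -> b = 1 %[mod 9] -> 1 < b ->
  [/\ x ^+ 9 = 1, y ^+ (3 ^ n.+1) = 1, c ^+ 3 = 1 &
      x ^+ 3 \in 'Z(G) /\ y ^+ 3 \in 'Z(G)].
Proof.
move=> pG defG rxy a7 b1 b_gt1.
have c3 := mac_comm_cube1 pG defG rxy a7 b1 b_gt1.
have Gx : x \in G by rewrite defG mem_gen ?set21.
have Gy : y \in G by rewrite defG mem_gen ?set22.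
have [px py] := (mem_p_elt pG Gx, mem_p_elt pG Gy).
have [] := mac_cube_consequences rxy a7 b1 b_gt1 px py.
- by rewrite c3; apply/commute_sym/commute1.
- by rewrite c3; apply/commute_sym/commute1.
move=> x9 y3n [_ _]; rewrite c3 invg1 !mul1g => x3y y3x; split=> //; split.
  apply: (mem_center_gen2 defG); rewrite ?groupX //; first exact/commute_sym/commuteX.
  exact/commgP/conjg_fixP.
apply: (mem_center_gen2 defG); rewrite ?groupX //; last exact/commute_sym/commuteX.
exact/commgP/conjg_fixP.
Qed.

(** [G] is the product <y><c><x>. Since c^x = c x^-6, the central x^3 is adjoined to <y><c> to
    obtain a subgroup normalized by [x]; it is absorbed by <x> afterwards. *)
Lemma mac3_card_le (gT : finGroupType) (G : {group gT}) (x y : gT) a b :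
    3.-group G -> G :=: <<[set x; y]>> -> mac_rels a b x y ->
    a = 7 %[mod 9] -> b = 1 %[mod 9] -> 1 < b ->
  #|G| <= #[x] * #[y] * #[[~ x, y]].
Proof.
move=> pG defG rxy a7 b1 b_gt1.
have [x9 _ _ [Zx3 _]] := mac3_basic pG defG rxy a7 b1 b_gt1.
have [_ /centP cx3] := setIP Zx3.
have Gx : x \in G by rewrite defG mem_gen ?set21.
have Gy : y \in G by rewrite defG mem_gen ?set22.
case: rxy; rewrite (expg_eq_mod x9 a7) -[[~ y, x]]invg_comm; set c := [~ x, y] => rx ry.
have Gc : c \in G by rewrite groupR.
have nyc : <[c]> \subset 'N(<[y]>).
  rewrite -cycleV cycle_subG; apply/normP; rewrite -cycleJ ry.
  apply/eqP; rewrite eqEcard cycle_subG mem_cycle -!orderE /= -ry orderJ leqnn //.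
set K := <[y]> <*> <[c]>.
have sKG : K \subset G by rewrite join_subG !cycle_subG Gy.
have cKx3 : <[x ^+ 3]> \subset 'N(K).
  rewrite cents_norm // cycle_subG; apply/centP => u Ku; apply: cx3.
  exact: (subsetP sKG).
set L := K <*> <[x ^+ 3]>.
have LE : L = K * <[x ^+ 3]> := norm_joinEr cKx3.
have Ly : y \in L by rewrite !mem_gen // inE mem_gen // inE cycle_id.
have Lc : c \in L by rewrite !mem_gen // inE mem_gen // inE cycle_id orbT.
have Lx3 : x ^+ 3 \in L by rewrite mem_gen // inE cycle_id orbT.
have nLx : <[x]> \subset 'N(L).
  rewrite cycle_subG inE /L -genJ gen_subG conjUg subUset.
  apply/andP; split; last first.
    rewrite -cycleJ cycle_subG; have -> : x ^+ 3 ^ x = x ^+ 3; last by [].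
    by apply/conjg_fixP/commgP/cx3.
  rewrite -genJ gen_subG conjUg subUset -!cycleJ !cycle_subG conjg_mulR -invg_comm.
  rewrite groupMl // groupV Lc /=.
  have -> : c ^ x = c * (x ^+ 3) ^- 2.
    have xc : x * c = c * x ^+ 7 by rewrite -rx; apply: conjgC.
    have cx : x * c ^ x = c * x := esym (conjgC c x).
    by apply: (mulgI x); rewrite cx mulgA xc (expgS x 6) mulgA -expgM mulgK.
  by rewrite groupMl // groupV groupX.
have sG : G \subset K * <[x]>.
  have -> : K * <[x]> = L <*> <[x]>.
    rewrite (norm_joinEr nLx : L <*> <[x]> = L * <[x]>) LE -mulgA; congr (_ * _).
    by rewrite mulSGid // cycle_subG mem_cycle.
  rewrite defG gen_subG subUset !sub1set; apply/andP; split.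
    by rewrite mem_gen // inE cycle_id orbT.
  by rewrite mem_gen // inE Ly.
apply: leq_trans (subset_leq_card sG) _.
have leM (A B : {group gT}) : #|A * B| <= #|A| * #|B|.
  by rewrite mul_cardG leq_pmulr // cardG_gt0.
apply: leq_trans (leM [group of K] [group of <[x]>]) _.
have leK : #|K| <= #[y] * #[c].
  rewrite (norm_joinEr nyc : K = <[y]> * <[c]>).
  exact: leM [group of <[y]>] [group of <[c]>].
by rewrite -mulnA mulnC leq_mul2l leK orbT.
Qed.

(** The order is bounded below as follows: <x^3><y^3> is central of order 3^(n+1), and [G] modulo it
    is a nonabelian 3-group, hence of order at least 27. *)
Lemma mac3_structure (gT : finGroupType) (G : {group gT}) (x y : gT) a b
    (c := [~ x, y]) (n := logn 3 b.-1) :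
    3.-group G -> G :=: <<[set x; y]>> -> mac_rels a b x y ->
    a = 7 %[mod 9] -> b = 1 %[mod 9] -> 1 < b ->
    x ^+ 3 != 1 -> y ^+ (3 ^ n) != 1 -> x ^+ 3 \notin <[y ^+ 3]> ->
  [/\ #|G| = (3 ^ (n + 4))%N, nil_class G = 3, #[x] = 9, #[y] = (3 ^ n.+1)%N & #[c] = 3].
Proof.
move=> pG defG rxy a7 b1 b_gt1 x3_nt y3_nt x3Ny3.
have [x9 y3n c3 [Zx3 Zy3]] := mac3_basic pG defG rxy a7 b1 b_gt1.
have leG := mac3_card_le pG defG rxy a7 b1 b_gt1.
rewrite -/n in y3n; rewrite -/c in c3 leG.
have n_gt0 : 0 < n.
  have /dvdnP[k Ek] : 9 %| b - 1 by rewrite -eqn_mod_dvd ?(ltnW b_gt1) //; apply/eqP.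
  rewrite logn_gt0 mem_primes /=; lia.
have Gx : x \in G by rewrite defG mem_gen ?set21.
have Gy : y \in G by rewrite defG mem_gen ?set22.
have Gc : c \in G by rewrite groupR.
have [rx ry] := rxy; rewrite (expg_eq_mod x9 a7) -/c in rx.
rewrite -[[~ y, x]]invg_comm -/c in ry.
have ordX (z : gT) k : z ^+ (3 ^ k.+1)%N = 1 -> z ^+ (3 ^ k)%N != 1 -> #[z] = (3 ^ k.+1)%N.
  move=> z1 z_nt; have : #[z] %| 3 ^ k.+1 by rewrite order_dvdn z1.
  case/(dvdn_pfactor _ _ (isT : prime 3)) => j le_j zE; rewrite zE; congr expn.
  apply/eqP; rewrite eqn_leq le_j ltnNge; apply: contra z_nt => le_jk.
  by rewrite -order_dvdn zE dvdn_exp2l.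
have ox : #[x] = 9 := ordX x 1%N x9 x3_nt.
have oy : #[y] = (3 ^ n.+1)%N := ordX y n y3n y3_nt.
(* A central [c] would give x^7 = x, against the order 9 of [x]. *)
have c_nZ : c \notin 'Z(G).
  apply/negP => /setIP[_ /centP cGc].
  have : x ^ c = x by apply/conjg_fixP/commgP/commute_sym/cGc.
  rewrite rx => /eqP; rewrite -[x in _ == x]expg1 eq_expg_mod_order ox //.
have oc : #[c] = 3.
  apply: (ordX c 0%N) => //; apply: contraNneq c_nZ => c1.
  by rewrite -[c]expg1 c1 group1.
pose Z0 := <[x ^+ 3]> * <[y ^+ 3]>.
have ox3 : #[x ^+ 3] = 3 by rewrite orderXdiv ox.
have cZ0 : #|Z0| = (3 ^ n.+1)%N.
  rewrite TI_cardMg.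
    by rewrite -!orderE ox3 orderXdiv oy ?dvdn_exp // expnS mulKn.
  by rewrite prime_TIg -?orderE ?ox3 // cycle_subG.
pose Z1 := (<[x ^+ 3]> <*> <[y ^+ 3]>)%G.
have sZ1 : Z1 \subset 'Z(G) by rewrite join_subG !cycle_subG Zx3.
have Z1E : Z1 :=: Z0.
  have cyx : <[y ^+ 3]> \subset 'C(<[x ^+ 3]>).
    rewrite cycle_subG /= cent_cycle; apply/cent1P.
    by have [_ /centP cx3] := setIP Zx3; apply/commute_sym/cx3/groupX.
  exact: norm_joinEr (cents_norm cyx).
have cZ1 : #|Z1| = (3 ^ n.+1)%N by rewrite Z1E.
have nZ1 : Z1 <| G := sub_center_normal sZ1.
have cGZ1 (H : {group gT}) : H <| G -> H \subset 'Z(G) -> ~~ abelian (G / H).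
  move=> nH sHZ; apply: contra c_nZ => abQ; apply: (subsetP sHZ).
  have /subsetP-> // : G^`(1) \subset H by rewrite der1_min ?normal_norm.
  exact: mem_commg.
have lQ : 3 <= logn 3 #|G / Z1|.
  rewrite ltnNge; apply: contra (cGZ1 _ nZ1 sZ1); exact: p2group_abelian (quotient_pgroup _ pG).
have oG : #|G| = (3 ^ (n + 4))%N.
  apply/eqP; rewrite eqn_leq; apply/andP; split.
    by apply: leq_trans leG _; rewrite ox oy oc addn4 !expnS; move: (3 ^ n)%N => t; clear; lia.
  rewrite -(Lagrange (normal_sub nZ1)) -card_quotient ?normal_norm // cZ1.
  have [e oQ] := p_natP (quotient_pgroup Z1 pG : 3.-nat #|G / Z1|).
  rewrite oQ -expnD leq_exp2l // addSnnS leq_add2l; by rewrite oQ pfactorK in lQ.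
have nilG := pgroup_nil pG.
have nZ := center_normal G.
have nZG : {subset G <= 'N('Z(G))} by apply/subsetP/normal_norm.
have [defQ rQ] := mac_quotient nZ defG rxy.
split=> //; set Q := (G / 'Z(G))%G.
(* [x, c] = x^6 and [y, c^-1] = y^(b - 1) are powers of the central cubes. *)
have QZ : [~ coset 'Z(G) x, coset 'Z(G) y] \in 'Z(Q).
  rewrite -morphR ?nZG // -/c; apply: (mem_center_gen2 defQ).
  - by rewrite mem_quotient.
  - apply/commute_sym/commgP; rewrite -morphR ?nZG //; apply/eqP/coset_id.
    rewrite commgEl rx (expgS x 6) mulKg; have -> : x ^+ 6 = x ^+ 3 ^+ 2 by rewrite -expgM.
    exact: groupX.
  rewrite -[c]invgK morphV ?groupV ?nZG //.
  apply/commute_sym/commuteV/commgP; rewrite -morphR ?groupV ?nZG //; apply/eqP/coset_id.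
  have /dvdnP[v bE] : 3 %| b.-1 by apply: dvdn_trans (pfactor_dvdnn 3 _); rewrite -/n dvdn_exp.
  by rewrite commgEl ry -(ltn_predK b_gt1) expgS mulKg bE mulnC expgM groupX.
have [defR _] := mac_quotient (center_normal Q) defQ rQ.
have abR : abelian (Q / 'Z(Q)).
  have nZQ : {subset Q <= 'N('Z(Q))} by apply/subsetP/normal_norm/center_normal.
  have [QX QY] : coset 'Z(G) x \in Q /\ coset 'Z(G) y \in Q by rewrite !mem_quotient.
  have cXY : commute (coset 'Z(Q) (coset 'Z(G) x)) (coset 'Z(Q) (coset 'Z(G) y)).
    by apply/commgP; rewrite -morphR ?nZQ //; apply/eqP/coset_id.
  rewrite defR abelian_gen; apply/centsP => u /set2P[]-> v /set2P[]->;
    by [exact: commute_refl | exact: cXY | exact/commute_sym/cXY].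
have nilQ : nilpotent Q := quotient_nil _ nilG.
(* Each quotient by the centre lowers the class by one, truncated at 0. The first quotient is not
   abelian and the second is, so the class is 3. *)
have := nil_class_quotient_center nilG; have := nil_class_quotient_center nilQ.
have := abR; rewrite -nil_class1.
have := cGZ1 _ nZ (subxx _); rewrite -nil_class1 -/Q.
by move: (nil_class G) (nil_class Q) (nil_class (Q / 'Z(Q))) => k1 k2 k3; clear; lia.
Qed.

(** * Permutation models for the lower bound *)

Lemma zexpgE (gT : finGroupType) (x : gT) N z g :
  x ^+ N = 1 -> (z == Posz g %[mod Posz N])%Z -> zexpg x z = x ^+ g.
Proof.
move=> xN; case: z => m /=.
  by rewrite !modz_nat eqz_nat => /eqP; apply: expg_eq_mod.
rewrite eqz_mod_dvd dvdzE /=.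
have -> : `|Negz m - Posz g|%N = (m.+1 + g)%N by lia.
case/dvdnP=> k Ek; apply/eqP; rewrite eq_invg_mul -expgD Ek mulnC expgM xN expg1n //.
Qed.

(* The permutations are s : x |-> x + 1 and t : x |-> x - d x (x + 1), and their
   commutator is u : x |-> x (1 + d); t is forced by t 0 = 0 and
   t (x + 1) = u (t x + 1), with - d playing the role of d / 2. *)
Lemma perm_model (R : finComNzRingType) (d : R) g :
    (d * d = 0)%R -> (d *+ 3 = 0)%R -> (g%:R = 1 + d)%R ->
  exists s t : {perm R}, [/\ s ^ [~ s, t] = s ^+ g, t ^ [~ t, s] = t,
    t ^+ 3 = 1 & forall j, (s ^+ j == 1) = (j%:R == 0 :> R)%R].
Proof.
move=> dd d3 gE.
pose ft (x : R) := (x - d * (x * (x + 1)))%R.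
(* As d^2 = 0, the correction d x (x + 1) is invariant under [ft]; three applications subtract it
   three times, that is, not at all. *)
have ftd x : (d * (ft x * (ft x + 1)) = d * (x * (x + 1)))%R.
  rewrite /ft; set y := (x * (x + 1))%R.
  have -> : (d * ((x - d * y) * (x - d * y + 1)) = d * y + d * d * (d * y * y - y * (x + x + 1)))%R.
    by rewrite /y; ring.
  by rewrite dd mul0r addr0.
have ft3 x : ft (ft (ft x)) = x.
  rewrite {1}/ft !ftd {1}/ft ftd {1}/ft.
  have -> : (x - d * (x * (x + 1)) - d * (x * (x + 1)) - d * (x * (x + 1)) =
    x - (d *+ 3) * (x * (x + 1)))%R by ring.
  by rewrite d3 mul0r subr0.
have t_inj : injective ft := can_inj (g := fun x => ft (ft x)) ft3.
pose t := perm t_inj; pose s := perm (addIr (1 : R)%R).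
have u_inj : injective (fun x : R => x * (1 + d))%R.
  apply: (can_inj (g := fun x => x * (1 - d))%R) => x.
  have -> : (x * (1 + d) * (1 - d) = x - x * (d * d))%R by ring.
  by rewrite dd mulr0 subr0.
pose u := perm u_inj.
have sX j x : (s ^+ j) x = (x + j%:R)%R.
  elim: j => [|j IHj]; first by rewrite expg0 perm1 addr0.
  by rewrite expgSr permM IHj permE -addrA -natr1.
have st : s * t = t * (s * u).
  apply/permP => x; rewrite !permM !permE /ft.
  have -> : ((x - d * (x * (x + 1)) + 1) * (1 + d) =
    x + 1 - d * ((x + 1) * (x + 1 + 1)) + d *+ 3 * (x + 1) - d * d * (x * (x + 1)))%R by ring.
  by rewrite dd d3 !mul0r addr0 subr0.
have su : s * u = u * s ^+ g.
  by apply/permP => x; rewrite !permM sX !permE gE; ring.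
have tu : t * u = u * t.
  apply/permP => x; rewrite !permM !permE /ft.
  have -> : (x * (1 + d) - d * (x * (1 + d) * (x * (1 + d) + 1)) =
    (x - d * (x * (x + 1))) * (1 + d) - d * d * (x * x + x * x * d))%R by ring.
  by rewrite dd mul0r subr0.
have cE : [~ s, t] = u.
  by rewrite commgEl; apply: (mulgI s); rewrite mulKVg; apply: (mulgI t); rewrite -conjgC.
exists s, t; split.
- by rewrite cE; apply: (mulgI u); rewrite -su -conjgC.
- by rewrite -invg_comm cE; apply/conjg_fixP/commgP/commuteV.
- by apply/permP => x; rewrite !expgS expg0 mulg1 !permM perm1 !permE.
move=> j; apply/eqP/eqP => [sj1 | j0].
  by have := sX j 0%R; rewrite sj1 perm1 add0r.
by apply/permP => x; rewrite sX j0 addr0 perm1.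
Qed.

(** The ring is Z/3^(k+1) and d is the class of gamma - 1, a multiple of 3^k; thus 3 d = 0, and d^2
    = 0 because 2 k >= k + 1. *)
Lemma mac_model k (gamma : int) :
    0 < k -> (gamma == 1 %[mod (3 ^ k)%N])%Z ->
  exists (hT : finGroupType) (s t : hT), [/\ s ^ [~ s, t] = zexpg s gamma,
    t ^ [~ t, s] = t, t ^+ 3 = 1 & forall j, (s ^+ j == 1) = (3 ^ k.+1 %| j)].
Proof.
move=> k_gt0 g1; set N := (3 ^ k.+1)%N.
have N_gt1 : 1 < N by rewrite (ltn_exp2l 0).
have natr0 j : (j%:R == 0 :> 'Z_N)%R = (N %| j).
  by rewrite -val_eqE /= val_Zp_nat.
pose g := `|(gamma %% N)%Z|%N.
have gE : (gamma == g %[mod N])%Z.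
  by rewrite gez0_abs ?modz_ge0 ?modz_mod // eqz_nat -lt0n ltnW.
have g1k : (Posz g == 1 %[mod (3 ^ k)%N])%Z.
  rewrite -(eqP g1) eq_sym eqz_mod_dvd; apply: dvdz_trans (_ : (Posz N %| _)%Z).
    by rewrite dvdzE /= dvdn_exp2l.
  by rewrite -eqz_mod_dvd.
have g_gt0 : 0 < g.
  case: (g) g1k => // /eqP; rewrite !modz_nat => -[]; rewrite mod0n modn_small //.
  by rewrite (ltn_exp2l 0).
have /dvdnP[v vE] : 3 ^ k %| g.-1.
  by rewrite -subn1 -eqn_mod_dvd //; move: g1k; rewrite !modz_nat.
have [||| s [t [sg tt t3 oN]]] := @perm_model ('Z_N) ((g.-1)%:R)%R g.
- apply/eqP; rewrite -natrM natr0 vE mulnACA -expnD dvdn_mull // dvdn_exp2l //; lia.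
- by apply/eqP; rewrite -mulrnA natr0 vE -mulnA -expnSr dvdn_mull.
- by rewrite -(natrD _ 1) add1n prednK.
exists {perm 'Z_N}, s, t; split=> // [|j]; last by rewrite oN natr0.
rewrite sg -(zexpgE _ gE) //; apply/eqP; rewrite oN natr0 //.
Qed.

(** * From integer to natural exponents, and from [G] to its Sylow 3-subgroup *)

Lemma natmod_rep (gamma : int) M (g := `|(gamma %% Posz M)%Z|%N) d :
  0 < M -> d %| M -> (gamma == g %[mod d])%Z.
Proof.
move=> M_gt0 dM; rewrite eqz_mod_dvd; apply: dvdz_trans (_ : (Posz M %| _)%Z).
  by rewrite dvdzE.
by rewrite -eqz_mod_dvd /g gez0_abs ?modz_ge0 ?modz_mod // eqz_nat -lt0n.
Qed.

(** Agreement modulo 3^(n+2) shows that 3^n divides b - 1 and 3^(n+1) does not; in particular b - 1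
    is nonzero. *)
Lemma natmod_logn3 (beta : int) M b (n := logn 3 `|(beta - 1)%R|%N) :
    beta != 1%R -> (beta == 1 %[mod 9])%Z -> 3 ^ n.+2 %| M ->
    (forall d, d %| M -> (beta == Posz b %[mod d])%Z) ->
  [/\ b = 1 %[mod 9], 1 < b & logn 3 b.-1 = n].
Proof.
move=> beta_n1 beta1 dvM bM.
have m_gt0 : 0 < `|(beta - 1)%R|%N by rewrite absz_gt0 subr_eq0.
have n_gt1 : 1 < n.
  by rewrite -pfactor_dvdn //; move: beta1; rewrite eqz_mod_dvd dvdzE.
have b1 : b = 1 %[mod 9].
  have := bM 9 (dvdn_trans (dvdn_exp2l 3 (isT : 2 <= n.+2)) dvM).
  by rewrite (eqP beta1) !modz_nat => /eqP[].
have b_gt0 : 0 < b by case: (b) b1.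
have dvE j : j <= n.+2 -> (3 ^ j %| b.-1) = (3 ^ j %| `|(beta - 1)%R|%N).
  move=> le_j; have := bM _ (dvdn_trans (dvdn_exp2l 3 le_j) dvM).
  have := eqz_mod_dvd (3 ^ j)%N beta 1; rewrite dvdzE /= => <- /eqP->.
  by rewrite !modz_nat eqz_nat -subn1 eqn_mod_dvd.
have b1_gt0 : 0 < b.-1.
  rewrite lt0n; apply/eqP => b10; have := dvE n.+1 (leqnSn _).
  by rewrite b10 dvdn0 pfactor_dvdn // ltnn.
split=> //; first by rewrite -ltn_predRL.
apply/eqP; rewrite eqn_leq -pfactor_dvdn // dvE ?(leqW (leqnSn n)) // pfactor_dvdn // leqnn andbT.
by rewrite leqNgt -pfactor_dvdn // dvE // pfactor_dvdn // ltnn.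
Qed.

(** [w] lies in the p'-core, so f w is both a p'-element and a p-element. Read backwards, this
    carries nontriviality from a model to the quotient by the p'-core. *)
Lemma coset_p'core_inj (gT rT : finGroupType) (G : {group gT}) (f : {morphism G >-> rT}) p e w :
    prime p -> w \in G -> coset 'O_p^'(G) w = 1 -> f w ^+ (p ^ e) = 1 -> f w = 1.
Proof.
move=> p_pr Gw w1 fwp; have Kw : w \in 'O_p^'(G).
  by apply: coset_idr w1; apply: (subsetP (gFnorm _ _)).
apply/eqP; rewrite -order_eq1 -dvdn1.
have p'fw : p^'.-elt (f w) by apply: morph_p_elt => //; apply: mem_p_elt (pcore_pgroup _ _) Kw.
have pfw : p.-elt (f w).
  by apply: pnat_dvd (_ : _ %| p ^ e) _; rewrite ?order_dvdn ?fwp // pnatX pnat_id.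
by rewrite (pnat_1 pfw p'fw).
Qed.

(** The quotient is a p-group, so [x] and its p-constituent have the same image; the projection
    preserves the order of p-elements, its kernel being a p'-group. *)
Lemma order_coset_p'core (gT : finGroupType) (G : {group gT}) (p : nat) x :
  prime p -> nilpotent G -> x \in G -> #[x.`_p] = #[coset 'O_p^'(G) x].
Proof.
move=> p_pr nilG Gx; set K := 'O_p^'(G).
have nK : {subset G <= 'N(K)} by apply/subsetP/gFnorm.
have pQ : p.-group (G / K).
  have [_ GE _ _] := dprodP (nilpotent_pcoreC p nilG).
  by rewrite -GE quotientMidr quotient_pgroup ?pcore_pgroup.
have Gz : x.`_p \in G by rewrite groupX.
have zQ : coset K x = coset K x.`_p.
  rewrite morph_constt ?nK // constt_p_elt //.
  by apply: mem_p_elt pQ _; rewrite mem_quotient.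
apply/eqP; rewrite eqn_dvd zQ morph_order ?nK // andbT order_dvdn.
have [e oz] := p_natP (p_elt_constt p x : p.-nat _).
apply/eqP; apply: (@coset_p'core_inj _ _ _ (idm_morphism G) p e); rewrite ?groupX //=.
  by rewrite morphX ?nK // expg_order.
by rewrite -expgM mulnC -oz expgM expg_order expg1n.
Qed.

Local Close Scope group_scope.

Theorem theorem10p2 (alpha beta : int) :
  beta != 1%R ->
  (alpha == 7 %[mod 9])%Z ->
  (beta == 1 %[mod 9])%Z ->
  forall (gT : finGroupType) (G : {group gT}) (A B : gT),
    is_Gab alpha beta G A B ->
    let n := logn 3 `|(beta - 1)%R|%N in
    forall P : {group gT}, P \in 'Syl_3(G)%g ->
      [/\ #|P| = 3 ^ (n + 4),
          nil_class P = 3,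
          #[A.`_3]%g = 9,
          #[B.`_3]%g = 3 ^ n.+1 &
          #[([~ A, B]).`_3]%g = 3].
Proof.
move=> beta_n1 alpha7 beta1 gT G A B [GA GB defG [rA rB] univ] n P sylP.
(* The orders of [A] and [B] let the exponents be reduced modulo [M]; the power of 3 preserves the
   residues modulo 9 and v_3(beta - 1). *)
pose M := (3 ^ n.+2 * (#[A]%g * #[B]%g))%N.
have M_gt0 : 0 < M by rewrite muln_gt0 expn_gt0 muln_gt0 !order_gt0.
pose a := `|(alpha %% M)%Z|%N; pose b := `|(beta %% M)%Z|%N.
have aM d : d %| M -> (alpha == a %[mod d])%Z := natmod_rep alpha M_gt0.
have bM d : d %| M -> (beta == b %[mod d])%Z := natmod_rep beta M_gt0.
have dv3 j : j <= n.+2 -> 3 ^ j %| M by move=> le_j; rewrite dvdn_mulr // dvdn_exp2l.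
have [b1 b_gt1 nE] := natmod_logn3 beta_n1 beta1 (dv3 _ (leqnn _)) bM; rewrite -/n in nE.
have a7 : a = 7 %[mod 9].
  by have := aM 9 (dv3 2 isT); rewrite (eqP alpha7) !modz_nat => /eqP[].
have rAB : mac_rels a b A B.
  split; first by rewrite rA; apply/zexpgE/aM; [apply: expg_order | rewrite dvdn_mull // dvdn_mulr].
  by rewrite rB; apply/zexpgE/bM; [apply: expg_order | rewrite !dvdn_mull].
have nilG : nilpotent G := mac_nilpotent defG rAB.
set K := 'O_3^'(G)%g.
have nK : {subset G <= 'N(K)%g} by apply/subsetP/gFnorm.
have [_ GE _ _] := dprodP (nilpotent_pcoreC 3 nilG).
have pQ : 3.-group%g (G / K)%g by rewrite -GE quotientMidr quotient_pgroup ?pcore_pgroup.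
have isoP : P \isog (G / K)%g.
  have -> : P :=: 'O_3(G)%g.
    by apply: nilpotent_Hall_pcore => //; move: sylP; rewrite inE.
  exact: sdprod_isog (dprodWsdC (nilpotent_pcoreC 3 nilG)).
have Gc : [~ A, B]%g \in G by rewrite groupR.
rewrite (card_isog isoP) (isog_nil_class isoP).
rewrite !(order_coset_p'core (isT : prime 3) nilG) // morphR ?nK //.
have [defQ rQ] := mac_quotient (pcore_normal 3^' G) defG rAB.
have mod3 (z w : int) : (z == w %[mod 9])%Z -> (z == w %[mod (3 ^ 1)%N])%Z.
  by rewrite !eqz_mod_dvd; apply: dvdz_trans.
have alpha3 : (alpha == 1 %[mod (3 ^ 1)%N])%Z.
  by rewrite (eqP (mod3 _ _ alpha7)).
have beta3 : (beta == 1 %[mod (3 ^ 1)%N])%Z := mod3 _ _ beta1.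
have betan : (beta == 1 %[mod (3 ^ n)%N])%Z.
  by rewrite eqz_mod_dvd dvdzE pfactor_dvdnn.
have n_gt0 : 0 < n.
  by rewrite -pfactor_dvdn ?absz_gt0 ?subr_eq0 //; move: beta3; rewrite eqz_mod_dvd dvdzE.
(* In the first model [A] is the translation, which gives A^3 <> 1; in the second [B] is, which
   gives B^(3^n) <> 1. The other generator has cube 1, so its relation holds for any exponent that
   is 1 modulo 3. *)
have [h1 [s1 [t1 [rs1 rt1 t13 os1]]]] := mac_model (isT : 0 < 1) alpha3.
have [h2 [s2 [t2 [rs2 rt2 t23 os2]]]] := mac_model n_gt0 betan.
have [f1 [f1A f1B]] : exists f : {morphism G >-> h1}, f A = s1 /\ f B = t1.
  apply: univ; split; first exact: rs1.
  by rewrite rt1 (zexpgE t13 beta3) expg1.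
have [f2 [f2A f2B]] : exists f : {morphism G >-> h2}, f A = t2 /\ f B = s2.
  apply: univ; split; last exact: rs2.
  by rewrite rt2 (zexpgE t23 alpha3) expg1.
have A3_nt : (coset K A ^+ 3 != 1)%g.
  rewrite -morphX ?nK //; apply/negP => /eqP A3.
  have := coset_p'core_inj (f := f1) (e := 1) (isT : prime 3) (groupX 3 GA) A3.
  rewrite morphX // f1A -expgM => s1_3.
  by have /eqP := s1_3 (eqP (etrans (os1 9) isT)); rewrite os1.
rewrite -nE; apply: (mac3_structure pQ defQ rQ a7 b1 b_gt1); rewrite ?nE //.
  rewrite -morphX ?nK //; apply/negP => /eqP B3.
  have := coset_p'core_inj (f := f2) (e := 1) (isT : prime 3) (groupX (3 ^ n) GB) B3.
  rewrite morphX // f2B -expgM -expnSr => s2_3.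
  have s2n : (s2 ^+ (3 ^ n.+1) = 1)%g by apply/eqP; rewrite os2.
  by have /eqP := s2_3 s2n; rewrite os2 dvdn_Pexp2l // ltnn.
(* If A^3 = B^(3i) in the quotient, the second model, where A^3 is trivial, forces 3^(n+1) to divide
   3 i. Then B^(3i), and with it A^3, is trivial in the quotient. *)
apply: contra A3_nt => /cycleP[i A3]; pose w := (A ^+ 3 * B ^- (3 * i))%g.
have Gw : w \in G by rewrite groupM ?groupV ?groupX.
have w1 : coset K w = 1%g.
  by rewrite morphM ?nK ?groupV ?groupX // morphV ?nK ?groupX // !morphX ?nK // A3 -expgM mulgV.
have fw : f2 w = (s2 ^- (3 * i))%g.
  by rewrite morphM ?groupV ?groupX // morphV ?groupX // !morphX // f2A f2B t23 mul1g.
have := coset_p'core_inj (f := f2) (e := n.+1) (isT : prime 3) Gw w1.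
rewrite fw expVgn -expgM => w3; have /eqP : (s2 ^- (3 * i) = 1)%g.
  by apply: w3; apply/eqP; rewrite invg_eq1 os2 dvdn_mull.
rewrite invg_eq1 os2 => /dvdnP[k Ek].
have [_ B3n _ _] := mac3_basic pQ defQ rQ a7 b1 b_gt1.
by rewrite A3 -expgM Ek mulnC expgM -nE B3n expg1n.
Qed.
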